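(* Let $\mathcal{F}$ be an $n$-periodic infinite frieze with quiddity sequence $q_{\mathcal{F}}=(a_1,a_2,\dots,a_n)$ such that $a_k=1$ for some $k\in\{1,2,\dots,n\}$. Then the $(n-1)$-tuple $$\check q_{\mathcal{F}}^{\,n}=\begin{cases}(a_{k+1}-2)&\text{if }n=2,\\ (a_1,\dots,a_{k-2},a_{k-1}-1,a_{k+1}-1,a_{k+2},\dots,a_n)&\text{otherwise},\end{cases}$$ where indices are reduced modulo $n$, is the quiddity sequence of an infinite frieze of period $n-1$.
   Context: An infinite frieze is an array $(m_{ij})_{i,j\in\mathbb{Z},\,j-i\ge -2}$ of integers with $m_{i,i-2}=0$ and $m_{i,i-1}=1$ for all $i\in\mathbb{Z}$, $m_{ij}>0$ for all $j\ge i$, and $m_{ij}m_{i+1,j+1}-m_{i+1,j}m_{i,j+1}=1$ for all $j-i\ge -1$. For an integer $n\ge1$ it is $n$-periodic (of period $n$; $n$ need not be the minimal period) if $m_{ij}=m_{i+n,j+n}$ for all $i\le j$. The quiddity sequence of an $n$-periodic infinite frieze is the $n$-tuple $(a_1,\dots,a_n)$, determined up to cyclic equivalence, with $a_i=m_{ii}$. (An entry $1$ in the quiddity sequence can occur only if $n\ge 2$.) The tuple in the case $n\ge3$ is obtained by removing the entry $a_k$ and decreasing its two cyclic neighbors by $1$; e.g. for $k=1$ it is $(a_2-1,a_3,\dots,a_{n-1},a_n-1)$. *)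

(* Defs.v *)
From mathcomp Require Import all_boot all_order all_algebra.

Set Implicit Arguments.
Unset Strict Implicit.
Unset Printing Implicit Defensive.

Import Order.TTheory GRing.Theory Num.Theory.
Local Open Scope ring_scope.

(* The array (m i j), j - i >= -2, is a total function on pairs of integers;
   its values below the row j = i - 2 are left unconstrained. *)
Record infinite_frieze (m : int -> int -> int) : Prop := InfiniteFrieze {
  frieze_row0 : forall i : int, m i (i - 2) = 0;
  frieze_row1 : forall i : int, m i (i - 1) = 1;
  frieze_gt0 : forall i j : int, i <= j -> 0 < m i j;
  frieze_diamond : forall i j : int, -1 <= j - i ->
    m i j * m (i + 1) (j + 1) - m (i + 1) j * m i (j + 1) = 1
}.

Definition frieze_periodic (n : nat) (m : int -> int -> int) : Prop :=
  (1 <= n)%N /\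
  forall i j : int, i <= j -> m i j = m (i + n%:Z) (j + n%:Z).

(* The index i : 'I_n (starting at 0) stands for the entry a_(i+1). *)
Definition frieze_quiddity (n : nat) (m : int -> int -> int) : n.-tuple int :=
  [tuple m (val i).+1%:Z (val i).+1%:Z | i < n].

(* Quiddity sequences are only determined up to cyclic equivalence. *)
Definition is_quiddity (n : nat) (m : int -> int -> int) (a : n.-tuple int) :
    Prop :=
  exists r : nat, a = rot r (frieze_quiddity n m) :> seq int.

(* ordS k and ord_pred k are the cyclic neighbours k + 1 and k - 1 modulo n;
   i |-> lift k i lists in increasing order the indices different from k. *)
Definition quiddity_cut (n : nat) (a : n.-tuple int) (k : 'I_n) :
    n.-1.-tuple int :=
  [tuple if n == 2%N then tnth a (ordS k) - 2
         else let j := lift k i in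
              if (j == ord_pred k) || (j == ordS k) then tnth a j - 1
              else tnth a j
  | i < n.-1].

(* Main.v *)
(** Put [c p q = m (p + 1) (q - 1)], the entry seen as the weight of an arc
    from vertex [p] to vertex [q]. The diamond rule and positivity give the
    three-term recursion [c p (q + 1) + c p (q - 1) = a_q * c p q], hence the
    Ptolemy relation
    [c p q * c r s - c r q * c p s = c p r * c q s] for [p <= r <= q <= s].
    Consequently, restricting [c] to any subsequence of vertices whose
    consecutive members are joined by arcs of weight [1] gives again an infinite
    frieze. Since [c (k - 1) (k + 1) = a_k = 1], the vertices that are not
    congruent to [k] modulo [n] form such a subsequence. *)
Require Import Defs.
From mathcomp Require Import all_boot all_order all_algebra.
From mathcomp Require Import zify ring lra.

Set Implicit Arguments.
Unset Strict Implicit.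
Unset Printing Implicit Defensive.

Import Order.TTheory GRing.Theory Num.Theory.
Local Open Scope ring_scope.

Definition arc (m : int -> int -> int) (p q : int) : int := m (p + 1) (q - 1).

Lemma int_ge_ind (p : int) (P : int -> Prop) :
  P p -> (forall q, p <= q -> P q -> P (q + 1)) -> forall q, p <= q -> P q.
Proof.
move=> P0 PS q lepq.
have -> : q = p + `|q - p|%N%:Z by lia.
elim: `|q - p|%N => [|d IHd]; first by rewrite addr0.
have -> : p + d.+1%:Z = p + d%:Z + 1 by lia.
by apply: PS => //; lia.
Qed.

(** * Arc weights and the Ptolemy relation *)

Section Frieze.

Variables (m : int -> int -> int) (hm : infinite_frieze m).

Lemma arcE i j p q : p + 1 = i -> q - 1 = j -> arc m p q = m i j.
Proof. by move=> <- <-. Qed.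

Lemma arc_id p : arc m p p = 0.
Proof. by rewrite -[RHS](frieze_row0 hm (p + 1)); apply: arcE; lia. Qed.

Lemma arc_next p q : p + 1 = q -> arc m p q = 1.
Proof.
by move=> <-; rewrite -[RHS](frieze_row1 hm (p + 1)); apply: arcE; lia.
Qed.

Lemma arc_gt0 p q : p < q -> 0 < arc m p q.
Proof.
move=> ltpq; have [<-|neq] := eqVneq (p + 1) q; first by rewrite arc_next.
by apply: (frieze_gt0 hm); lia.
Qed.

Lemma arc_diamond p q : p < q ->
  arc m p q * arc m (p + 1) (q + 1) - arc m (p + 1) q * arc m p (q + 1) = 1.
Proof.
move=> ltpq; have := @frieze_diamond _ hm (p + 1) (q - 1) ltac:(lia).
by rewrite /arc (_ : q + 1 - 1 = q - 1 + 1) //; lia.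
Qed.

(** Descending induction on [p] from [q - 1]: the diamonds at [(p, q)] and [(p, q - 1)] both equal
    1, so the ratio of the left side to [arc m p q] is the same for [p] and [p + 1]. *)
Lemma arc_recursion p q : p < q ->
  arc m p (q + 1) + arc m p (q - 1) = m q q * arc m p q.
Proof.
(* Negating [p] turns the descending induction into an ascending one. *)
move=> ltpq; pose P x := arc m (- x) (q + 1) + arc m (- x) (q - 1)
                         = m q q * arc m (- x) q.
suff: P (- p) by rewrite /P opprK.
apply: (@int_ge_ind (1 - q)) => [|x lex IHx|]; last by lia.
  rewrite /P (_ : - (1 - q) = q - 1); last by lia.
  by rewrite arc_id (@arc_next _ q) ?subrK // mulr1 addr0; apply: arcE; lia.
rewrite /P; set y := - (x + 1).
move: IHx; rewrite /P (_ : - x = y + 1); last by rewrite /y; lia.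
move=> IHx.
have lty : y + 1 < q by rewrite /y; lia.
have D1 := @arc_diamond y q ltac:(lia).
have := @arc_diamond y (q - 1) ltac:(lia).
rewrite subrK => D2.
have /lt0r_neq0 nz := arc_gt0 lty.
apply: (mulfI nz); move: IHx D1 D2.
set u := arc m (y + 1) (q + 1); set v := arc m (y + 1) (q - 1).
move=> IHx; have -> : u = m q q * arc m (y + 1) q - v by rewrite -IHx addrK.
move=> D1 D2; nra.
Qed.

(* Any two consecutive rows [b], [b + 1] are coordinates in which [arc m] is
   the 2 x 2 determinant, since both sides solve the same recursion in [q]. *)
Lemma arc_det b p q : b < p -> p <= q ->
  arc m p q = arc m b p * arc m (b + 1) q - arc m b q * arc m (b + 1) p.
Proof.
move=> ltbp lepq; pose E x :=
  arc m p x = arc m b p * arc m (b + 1) x - arc m b x * arc m (b + 1) p.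
suff: E q /\ E (q + 1) by case.
apply: (@int_ge_ind p (fun x => E x /\ E (x + 1))) => //.
  split; rewrite /E; first by rewrite arc_id; ring.
  by rewrite (arc_next erefl) -[LHS](arc_diamond ltbp); ring.
move=> x lepx [Ex Ex1]; split=> //.
have R y : y < x + 1 ->
    arc m y (x + 1 + 1) = m (x + 1) (x + 1) * arc m y (x + 1) - arc m y x.
  by move=> lty; rewrite -arc_recursion // addrK addrK.
rewrite /E !R; try lia.
by move: Ex Ex1; rewrite /E => -> ->; ring.
Qed.

(** In coordinates given by rows [p - 1] and [p], all six arcs are 2 x 2 determinants, and this is
    the Plücker relation. *)
Lemma arc_ptolemy p r q s : p <= r -> r <= q -> q <= s ->
  arc m p q * arc m r s - arc m r q * arc m p s = arc m p r * arc m q s.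
Proof.
move=> lepr lerq leqs.
have D x y : p <= x -> x <= y -> arc m x y = arc m (p - 1) x
    * arc m (p - 1 + 1) y - arc m (p - 1) y * arc m (p - 1 + 1) x.
  by move=> lepx lexy; apply: arc_det; lia.
by rewrite (D p q) ?(D r s) ?(D r q) ?(D p s) ?(D p r) ?(D q s); [ring|lia..].
Qed.

(** * Friezes on subsequences of vertices *)

Variables (phi : int -> int) (phi_lt : forall x, phi x < phi (x + 1)).

Lemma phi_mono x y : x <= y -> phi x <= phi y.
Proof.
move: y; apply: int_ge_ind => // y _ /le_trans; apply.
exact: ltW.
Qed.

Lemma infinite_frieze_subsequence :
  (forall x, arc m (phi x) (phi (x + 1)) = 1) ->
  infinite_frieze (fun i j => arc m (phi (i - 1)) (phi (j + 1))).
Proof.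
move=> phi1; split=> [i|i|i j leij|i j leij].
- have -> : i - 2 + 1 = i - 1 by lia.
  by rewrite arc_id.
- by rewrite phi1.
- apply: arc_gt0; apply: (lt_le_trans (phi_lt _)); apply: phi_mono; lia.
have -> : i + 1 - 1 = i - 1 + 1 by lia.
(* The two arcs on the right of Ptolemy join consecutive vertices, so their product is 1. *)
rewrite arc_ptolemy ?phi1 ?mulr1 //; apply: phi_mono; lia.
Qed.

(* [L] and [R] tell whether a vertex is skipped just before and just after
   [phi x]. *)
Variables (L R : bool) (x : int).

(** The recursion at [phi x] moves the left end out and costs [L]; Ptolemy then moves the right end
    out and costs [R]. *)
Lemma subsequence_diag :
  phi (x - 1) = phi x - 1 - L%:Z -> phi (x + 1) = phi x + 1 + R%:Z ->
  (L -> m (phi x - 1) (phi x - 1) = 1) ->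
  (R -> m (phi x + 1) (phi x + 1) = 1) ->
  arc m (phi (x - 1)) (phi (x + 1)) = m (phi x) (phi x) - L%:Z - R%:Z.
Proof.
move=> -> ->; set P := phi x => L1 R1.
have D0 p q : p + 1 = q - 1 -> arc m p q = m (p + 1) (p + 1).
  by move=> e; rewrite /arc -e.
have aL : arc m (P - 1 - L%:Z) P = 1.
  case: L L1 => [/(_ isT) L1|_]; last by rewrite arc_next //; lia.
  by rewrite D0; [rewrite -L1; congr m; lia|lia].
have aR : arc m P (P + 1 + R%:Z) = 1.
  case: R R1 => [/(_ isT) R1|_]; last by rewrite arc_next //; lia.
  by rewrite D0 //; lia.
have leL : P - 1 - L%:Z <= P - 1 by case: (L); lia.
have leR : P + 1 <= P + 1 + R%:Z by case: (R); lia.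
have aLm : arc m (P - 1 - L%:Z) (P - 1) = L%:Z.
  by case: (L); [rewrite arc_next //; lia|rewrite subr0 arc_id].
have aRm : arc m (P + 1) (P + 1 + R%:Z) = R%:Z.
  by case: (R); [rewrite arc_next //; lia|rewrite addr0 arc_id].
have T1 := @arc_recursion (P - 1 - L%:Z) P ltac:(lia).
have T2 := @arc_ptolemy (P - 1 - L%:Z) P (P + 1) (P + 1 + R%:Z)
             ltac:(lia) ltac:(lia) leR.
rewrite (@arc_next P (P + 1)) // in T2.
move: T1 T2; rewrite aL aR aLm aRm !mulr1 !mul1r => T1 T2; lia.
Qed.

End Frieze.

(** * Periodicity and indexing *)

Lemma periodic_diag (n : nat) (m : int -> int -> int) (x t : int) :
  frieze_periodic n m -> m (x + t * n%:Z) (x + t * n%:Z) = m x x.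
Proof.
case=> _ per.
have up (d : nat) y : m (y + d%:Z * n%:Z) (y + d%:Z * n%:Z) = m y y.
  elim: d y => [|d IHd] y; first by rewrite mul0r addr0.
  rewrite -[RHS]IHd [RHS]per //; congr m; lia.
case: (leP 0 t) => t0; first by rewrite (_ : t = `|t|%N%:Z) ?up //; lia.
rewrite -(up `|t|%N (x + t * n%:Z)); congr m; nia.
Qed.

Lemma is_quiddityP (n : nat) (m : int -> int -> int) (a : n.-tuple int) :
  frieze_periodic n m -> is_quiddity m a ->
  exists r : int, forall i : 'I_n, tnth a i = m (i%:Z + r) (i%:Z + r).
Proof.
move=> per [r aE].
have nthq (j : nat) : (j < n)%N ->
    nth 0 (frieze_quiddity n m) j = m (j%:Z + 1) (j%:Z + 1).
  move=> ltj; have -> : j = Ordinal ltj by [].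
  by rewrite -tnth_nth tnth_mktuple /=; congr m; lia.
have sq : size (frieze_quiddity n m) = n by rewrite size_tuple.
case: (leqP n r) => [lenr|ltrn].
  (* An oversized rotation is the identity; the shift 1 remains because the quiddity tuple starts at
     diagonal index 1. *)
  exists 1 => i; rewrite (tnth_nth 0) aE rot_oversize ?sq //.
  by rewrite nthq.
exists (r%:Z + 1) => i; rewrite (tnth_nth 0) aE nth_cat size_drop sq.
have lti := ltn_ord i; case: ltnP => [lt1|le1].
  by rewrite nth_drop nthq; [congr m|]; lia.
rewrite nth_take ?nthq; try lia.
by rewrite -(@periodic_diag n m _ 1) //; congr m; lia.
Qed.

(* Increasing enumeration of the integers not congruent to [-1] modulo
   [N + 1]. *)
Definition skip (N : nat) (z : int) : int := z + (z %/ N%:Z)%Z.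

Lemma skip_period (N : nat) (z : int) : (0 < N)%N ->
  skip N (z + N%:Z) = skip N z + N.+1%:Z.
Proof.
move=> N0; rewrite /skip.
have -> : ((z + N%:Z) %/ N%:Z)%Z = 1 + (z %/ N%:Z)%Z.
  by rewrite addrC -{1}[N%:Z]mul1r divzMDl // eqz_nat -lt0n.
lia.
Qed.

Lemma skip_next (N : nat) (z : int) : (0 < N)%N ->
  skip N (z + 1) = skip N z + 1 + (N%:Z %| z + 1)%Z%:Z.
Proof.
move=> N0; have nzN : N%:Z != 0 by rewrite eqz_nat -lt0n.
rewrite /skip; set q := (z %/ N%:Z)%Z; set e := (z %% N%:Z)%Z.
have e_ge0 : 0 <= e := modz_ge0 z nzN.
have e_lt : e < N%:Z by apply: ltz_pmod.
have zE : z + 1 = q * N%:Z + (e + 1) by rewrite addrA -divz_eq.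
have [eN|neN] := eqVneq (e + 1) N%:Z.
  have -> : z + 1 = (q + 1) * N%:Z by rewrite zE eN mulrDl mul1r.
  rewrite mulzK // dvdz_mull //; move: zE; rewrite eN; lia.
have eb : 0 <= e + 1 < N%:Z by apply/andP; split; lia.
have -> : (N%:Z %| z + 1)%Z = false.
  by apply/dvdz_mod0P; rewrite zE modzMDl modz_small //; lia.
by rewrite {2}zE divzMDl // divz_small ?absz_nat //; lia.
Qed.

(** Reduces divisibility to linear equalities, so that skipped vertices can be matched with cyclic
    neighbours of [k]. *)
Lemma dvdz_small (N : nat) (z : int) : (0 < N)%N -> `|z| <= N%:Z ->
  (N%:Z %| z)%Z = [|| z == 0, z == N%:Z | z == - N%:Z].
Proof.
move=> N0 leN; apply/dvdzP/or3P => [[q zE]|[] /eqP ->].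
- have [q0|[q1|q1]] : q = 0 \/ q = 1 \/ q = -1 by nia.
  + by constructor 1; rewrite zE q0 mul0r.
  + by constructor 2; rewrite zE q1 mul1r.
  by constructor 3; rewrite zE q1 mulN1r.
- by exists 0; rewrite mul0r.
- by exists 1; rewrite mul1r.
by exists (-1); rewrite mulN1r.
Qed.

Lemma val_ordS (n : nat) (k : 'I_n) :
  val (ordS k) = if k.+1 == n then 0%N else k.+1.
Proof.
rewrite /=; case: eqP => [->|neq]; first by rewrite modnn.
by rewrite modn_small //; have := ltn_ord k; lia.
Qed.

Lemma val_ord_pred (n : nat) (k : 'I_n) :
  val (ord_pred k) = if k == 0%N :> nat then n.-1 else k.-1.
Proof.
have ltk := ltn_ord k; rewrite /=; case: eqP => [k0|nz].
  by rewrite k0 modn_small; lia.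
have -> : (k + n).-1 = (k.-1 + n)%N by lia.
by rewrite modnDr modn_small //; lia.
Qed.

(** Otherwise the diamond at [(x, x)] forces [m x (x + 1) = 0]. This rules out [n = 1] in the
    theorem. *)
Lemma periodic1_diag_neq1 (m : int -> int -> int) (x : int) :
  infinite_frieze m -> frieze_periodic 1 m -> m x x != 1.
Proof.
move=> hm [_ per]; apply/eqP => mx.
have := @frieze_diamond _ hm x x ltac:(lia).
rewrite -per // mx; have := frieze_row1 hm (x + 1); rewrite addrK => ->.
by have := @frieze_gt0 _ hm x (x + 1) ltac:(lia); lia.
Qed.

Theorem proposition2p9 (n : nat) (m : int -> int -> int)
    (hm : infinite_frieze m) (hper : frieze_periodic n m)
    (a : n.-tuple int) (ha : is_quiddity m a)
    (k : 'I_n) (hk : tnth a k = 1) :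
  exists m' : int -> int -> int,
    [/\ infinite_frieze m', frieze_periodic n.-1 m' &
        is_quiddity m' (quiddity_cut a k)].
Proof.
have [r aE] := is_quiddityP hper ha.
have ltk := ltn_ord k.
pose N := n.-1; have nE : n = N.+1 by rewrite prednK //; case: hper.
pose K : int := k%:Z + r; have mK : m K K = 1 by rewrite -aE.
have N0 : (0 < N)%N.
  rewrite lt0n; apply/eqP => N0; have n1 : n = 1%N by rewrite nE N0.
  by have := @periodic1_diag_neq1 m K hm; rewrite -{1}n1 mK => /(_ hper).
(* The shift makes [phi (i + 1)] the vertex [lift k i + r], see [phix] below, so
   that no rotation of the new quiddity sequence is needed. *)
pose phi (x : int) : int := K + 1 + skip N (x - 1 - k%:Z).
have phi_next (x : int) : phi (x + 1) = phi x + 1 + (N%:Z %| x - k%:Z)%Z%:Z.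
  rewrite /phi (_ : x + 1 - 1 - k%:Z = x - 1 - k%:Z + 1); last by lia.
  by rewrite skip_next // (_ : x - 1 - k%:Z + 1 = x - k%:Z) ?addrA //; lia.
have phi_lt (x : int) : phi x < phi (x + 1) by rewrite phi_next; lia.
have phi_skip (x : int) : (N%:Z %| x - k%:Z)%Z -> m (phi x + 1) (phi x + 1) = 1.
  move=> dvdx; have /dvdzP[t xE] := dvdx.
  have -> : phi x + 1 = K + t * n%:Z.
    have -> : phi x + 1 = phi (x + 1) - 1 by rewrite phi_next dvdx; lia.
    rewrite /phi /skip (_ : x + 1 - 1 - k%:Z = t * N%:Z); last by lia.
    by rewrite mulzK ?eqz_nat -?lt0n // nE; lia.
  by rewrite periodic_diag.
(* Either the two vertices are adjacent, or the arc spans one skipped vertex and its weight is the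
   diagonal entry 1 there. *)
have phi1 (x : int) : arc m (phi x) (phi (x + 1)) = 1.
  rewrite phi_next; case: (boolP (N%:Z %| _)%Z) => [/phi_skip mx|_].
    by rewrite -[RHS]mx; apply: arcE; lia.
  by apply: arc_next => //; lia.
have phi_period (x : int) : phi (x + N%:Z) = phi x + n%:Z.
  rewrite /phi (_ : x + N%:Z - 1 - k%:Z = x - 1 - k%:Z + N%:Z); last by lia.
  by rewrite skip_period // -nE addrA.
exists (fun i j : int => arc m (phi (i - 1)) (phi (j + 1))); split.
- exact: infinite_frieze_subsequence.
- split=> // i j leij.
  rewrite (_ : i + n.-1%:Z - 1 = i - 1 + N%:Z); last by rewrite /N; lia.
  rewrite (_ : j + n.-1%:Z + 1 = j + 1 + N%:Z); last by rewrite /N; lia.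
  have lt1 := phi_lt (i - 1); have lt2 := phi_lt (i - 1 + 1).
  have le3 : phi (i - 1 + 1 + 1) <= phi (j + 1).
    by apply: (phi_mono phi_lt); lia.
  rewrite !phi_period /arc; case: hper => _ ->; last by lia.
  by congr m; lia.
exists 0%N; rewrite rot0; congr (val _); apply: eq_from_tnth => i.
rewrite !tnth_mktuple.
have lti : (i < N)%N := ltn_ord i.
have valL : val (lift k i) = ((k <= i) + i)%N by [].
set x : int := (val i).+1%:Z; have xE : x = i%:Z + 1 by rewrite /x /=; lia.
have phix : phi x = (val (lift k i))%:Z + r.
  rewrite valL /phi /skip (_ : x - 1 - k%:Z = i%:Z - k%:Z); last by lia.
  (* The quotient in [skip] is 0 for [k <= i] and -1 for [i < k], which reproduces the jump of
     [lift k]. *)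
  case: leqP => [leki|ltik].
    by rewrite divz_small ?absz_nat /K; lia.
  have -> : i%:Z - k%:Z = (-1) * N%:Z + (i%:Z - k%:Z + N%:Z) by lia.
  rewrite divzMDl ?eqz_nat -?lt0n // divz_small ?absz_nat /K; lia.
pose L := (N%:Z %| x - 1 - k%:Z)%Z; pose R := (N%:Z %| x - k%:Z)%Z.
have nextL : phi x = phi (x - 1) + 1 + L%:Z by rewrite -phi_next subrK.
rewrite (@subsequence_diag _ hm phi L R); first last.
- exact: phi_skip.
- by move=> L1; rewrite -[RHS](phi_skip _ L1); congr m; rewrite nextL L1; lia.
- exact: phi_next.
- by rewrite nextL; lia.
have -> : m (phi x) (phi x) = tnth a (lift k i) by rewrite aE phix.
(* A vertex skipped just before [phi x] is a copy of [k], so [lift k i] is its successor; [R]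
   likewise gives the predecessor. *)
have LE : L = (lift k i == ordS k).
  rewrite -val_eqE val_ordS valL /L dvdz_small //; last by lia.
  by rewrite xE; case: (leqP k i) => ?; case: (k.+1 =P n) => ?;
    apply/idP/idP; lia.
have RE : R = (lift k i == ord_pred k).
  rewrite -val_eqE val_ord_pred valL /R dvdz_small //; last by lia.
  by rewrite xE; case: (leqP k i) => ?; case: (nat_of_ord k =P 0%N) => ?;
    apply/idP/idP; lia.
(* For [n = 2] the only remaining vertex is both neighbours of [k], hence the decrease by 2;
   otherwise the neighbours differ and [L], [R] exclude each other. *)
case: eqVneq => [n2|nn2].
  have N1 : N = 1%N by lia.
  have L1 : L by rewrite /L N1 dvd1z.
  have R1 : R by rewrite /R N1 dvd1z.
  have /eqP <- : lift k i == ordS k by rewrite -LE.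
  by rewrite L1 R1; lia.
rewrite /= -LE -RE.
have : ~~ (L && R).
  rewrite LE RE -!val_eqE val_ordS val_ord_pred valL.
  by case: (k.+1 =P n) => ?; case: (nat_of_ord k =P 0%N) => ?; lia.
by case: (L); case: (R) => //=; lia.
Qed.
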